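(* Fix any integer $k\ge 3$. Then, for every integer $r\ge 1$, the $k$-graph $F^k_r$ is not $r$-colourable and satisfies $\gamma(F^k_r)=\frac{r-1}{r}$.
   Context: A $k$-graph ($k$-uniform hypergraph) $H$ consists of a vertex set $V(H)$ and an edge set $E(H)\subseteq\binom{V(H)}{k}$. For a $(k-1)$-subset $S\subseteq V(H)$, $d_H(S)$ is the number of edges of $H$ containing $S$, and $\delta_{k-1}(H)$ is the minimum of $d_H(S)$ over all $(k-1)$-subsets $S$. For a $k$-graph $F$, $\mathrm{co\text{-}ex}(n,F)$ is the maximum of $\delta_{k-1}(H)$ over all $n$-vertex $k$-graphs $H$ not containing $F$ as a (not necessarily induced) subgraph, and $\gamma(F)=\lim_{n\to\infty}\mathrm{co\text{-}ex}(n,F)/n$ (this limit is known to exist). A $k$-graph $F$ is $r$-colourable if $V(F)$ can be partitioned into $r$ sets $A_1,\dots,A_r$ such that no edge of $F$ lies entirely inside some $A_i$. The $k$-graphs $F^k_r$ are defined inductively on $r$. $F^k_1$ is a single edge (a $k$-graph with $k$ vertices and one edge). For $r\ge 2$: let $S$ be a set of $r(k-2)+1$ vertices, let $m=\binom{r(k-2)+1}{k-1}$, and enumerate the $(k-1)$-subsets of $S$ as $X_1,\dots,X_m$. For each $j\in[m]$ let $\tilde X_j$ be a copy of $F^k_{r-1}$, these copies being pairwise vertex-disjoint and disjoint from $S$. Then $V(F^k_r)=S\cup\bigcup_{j=1}^m V(\tilde X_j)$ and \[E(F^k_r)=\{X_j\cup\{v\}: j\in[m],\ v\in V(\tilde X_j)\}\cup\bigcup_{j=1}^m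 E(\tilde X_j).\] *)

(* Defs.v *)
From mathcomp Require Import all_boot all_order all_algebra.
From mathcomp Require Import all_classical all_reals all_analysis.

Set Implicit Arguments.
Unset Strict Implicit.
Unset Printing Implicit Defensive.

Import numFieldNormedType.Exports.

Record hypergraph := Hypergraph {
  vert :> finType;
  edges : {set {set vert}}
}.

Definition uniform (k : nat) (H : hypergraph) : bool :=
  [forall e in edges H, #|e| == k].

Definition degree (H : hypergraph) (S : {set H}) : nat :=
  #|[set e in edges H | S \subset e]|.

(* In a k-graph every degree is at most #|H|, so this default does not affect
   the minimum unless H has fewer than k - 1 vertices. *)
Definition min_codegree (k : nat) (H : hypergraph) : nat :=
  \big[minn/#|H|]_(S : {set H} | #|S| == k.-1) degree S.

Definition contains (F H : hypergraph) : bool :=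
  [exists f : {ffun F -> H},
    injectiveb f && [forall e in edges F, f @: e \in edges H]].

Definition coex (k n : nat) (F : hypergraph) : nat :=
  \max_(E : {set {set 'I_n}} |
        uniform k (Hypergraph E) && ~~ contains F (Hypergraph E))
    min_codegree k (Hypergraph E).

Definition coex_ratio (R : realType) (k : nat) (F : hypergraph) : R^nat :=
  fun n => ((coex k n F)%:R / n%:R)%R.

Definition codegree_density (R : realType) (k : nat) (F : hypergraph) : R :=
  limn (coex_ratio R k F).

Definition colourable (r : nat) (F : hypergraph) : Prop :=
  exists A : 'I_r -> {set F},
    [/\ \bigcup_(i < r) A i = [set: F]%SET,
        forall i j, i != j -> [disjoint A i & A j]
      & forall e i, e \in edges F -> ~~ (e \subset A i)].

Definition single_edge (k : nat) : hypergraph :=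
  @Hypergraph 'I_k [set [set: 'I_k]%SET]%SET.

Section Extension.
Variables (k s : nat) (G : hypergraph).

(* The (k-1)-subsets of S = 'I_s themselves index the copies of G. *)
Definition ksub : finType := {X : {set 'I_s} | #|X| == k.-1}.

(* inl x is the vertex x of S; inr (X, v) is the vertex v of the copy of G
   attached to X. *)
Definition ext_vert : finType := ('I_s + ksub * G)%type.

Definition link_edge (X : ksub) (v : G) : {set ext_vert} :=
  (inr (X, v) |: [set inl x | x in val X])%SET.

Definition copy_edge (X : ksub) (e : {set G}) : {set ext_vert} :=
  [set inr (X, v) | v in e]%SET.

Definition ext : hypergraph :=
  @Hypergraph ext_vert
    ([set link_edge X v | X in [set: ksub], v in [set: G]]
     :|: [set copy_edge X e | X in [set: ksub], e in edges G])%SET.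

End Extension.

(* F^k_r for r >= 1; the value at r = 0 is a dummy. *)
Fixpoint Fkr (k r : nat) : hypergraph :=
  match r with
  | 0 => single_edge k
  | r'.+1 => if r' == 0 then single_edge k
             else ext k (r * (k - 2) + 1) (Fkr k r')
  end.

Lemma uniform_Fkr (k r : nat) : 0 < k -> uniform k (Fkr k r).
Proof.
move=> k0; have E : uniform k (single_edge k).
  by apply/forall_inP => e /set1P ->; rewrite cardsT card_ord.
elim: r => [//|r IH] /=; case: ifP => // _.
apply/forall_inP => e /setUP [] /imset2P [X v _].
- move=> _ ->; rewrite cardsU1 card_imset; last by move=> x y [].
  rewrite (eqP (valP X)).
  have -> : inr (X, v) \notin [set inl x | x in val X]%SET.
    by apply/negP => /imsetP [].
  by rewrite add1n prednK.
- move=> ve ->; rewrite card_imset; last by move=> x y [].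
  by move/forall_inP: IH; apply.
Qed.

(* Main.v *)
(* Non-colourability: by pigeonhole some colour covers a (k-1)-set X of S, so the
   copy attached to X misses that colour, and one concludes by induction on r.
   Non-r-colourability gives the lower bound on the codegree: the n-vertex
   k-graph whose edges are the k-sets not inside a residue class mod r is
   r-colourable, and it has codegree at least n - n/r - k.
   For the upper bound, let every (k-1)-set of a vertex set U have at most d
   non-neighbours in U. If |U| >= r * d + C, embed S anywhere in U, then embed
   the copies of F_{r-1} one at a time: the one attached to X goes into the
   unused vertices of the neighbourhood of X in U, of which there are at least
   (r - 1) * d + C', again with at most d non-neighbours of each (k-1)-set. *)

Require Import Defs.
From mathcomp Require Import all_boot all_order all_algebra.
From mathcomp Require Import all_classical all_reals all_analysis.
From mathcomp Require Import zify lra.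

Set Implicit Arguments.
Unset Strict Implicit.

Import Order.TTheory GRing.Theory Num.Theory.
Import numFieldNormedType.Exports.

(** * Colourings and the non-colourability of [Fkr] *)

Lemma subset_of_card (T : finType) (A : {set T}) (n : nat) :
  n <= #|A| -> exists2 B : {set T}, B \subset A & #|B| = n.
Proof.
move=> /card_geqP [s [us ss sA]]; exists [set x in s]%SET.
  by apply/fintype.subsetP => x; rewrite inE => /sA.
by rewrite cardsE (card_uniqP us).
Qed.

(** Colour maps, unlike partitions, compose directly with embeddings and restrict to the copies
    inside [ext]. *)
Lemma colourableP (r : nat) (F : hypergraph) :
  colourable r F <->
  exists c : F -> 'I_r, forall e i, e \in edges F ->
    ~~ (e \subset [set v | c v == i]%SET).
Proof.
split=> [[A [covA _ Ae]]|[c ce]].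
  have /boolp.choice [c cA] : forall v : F, exists i, v \in A i.
    move=> v; have := finset.in_setT v; rewrite -covA => /finset.bigcupP [i _ vi].
    by exists i.
  exists c => e i /Ae => /(_ i); apply: contra => /fintype.subsetP ei.
  by apply/fintype.subsetP => v /ei; rewrite inE => /eqP <-.
exists (fun i => [set v | c v == i]%SET); split=> [|i j ij|//].
  apply/setP => v; rewrite finset.in_setT; apply/finset.bigcupP.
  by exists (c v); rewrite ?inE.
by apply/pred0P => v /=; rewrite !inE; apply: contraNF ij => /andP [/eqP <-].
Qed.

Lemma colourable_contains (r : nat) (F H : hypergraph) :
  contains F H -> colourable r H -> colourable r F.
Proof.
move=> /existsP [f /andP [_ /forall_inP fe]] /colourableP [c ce].
apply/colourableP; exists (c \o f) => e i eF.
apply: contra (ce _ i (fe _ eF)) => /fintype.subsetP ei.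
by apply/fintype.subsetP => _ /imsetP [v /ei + ->]; rewrite !inE.
Qed.

Lemma single_edge_not_colourable (k : nat) : ~ colourable 1 (single_edge k).
Proof.
move=> /colourableP [c /(_ [set: 'I_k]%SET ord0)].
rewrite inE eqxx => /(_ isT) /negP; apply; apply/fintype.subsetP => v _.
by rewrite inE ord1.
Qed.

Lemma ext_not_colourable (k s r : nat) (G : hypergraph) :
  1 < k -> r.+1 * (k - 2) < s ->
  ~ colourable r G -> ~ colourable r.+1 (ext k s G).
Proof.
move=> k1 sr nG /colourableP [c ce]; apply: nG; apply/colourableP.
pose S i := [set x : 'I_s | c (inl x) == i]%SET.
have [i /subset_of_card [X XS /eqP cX]] : exists i, k.-1 <= #|S i|.
  (* Otherwise each of the [r.+1] colour classes on [S] has at most [k - 2] vertices, which forces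
     [s <= r.+1 * (k - 2)]. *)
  apply/existsP; apply: contraLR sr => /existsPn small.
  rewrite -leqNgt -{1}(card_ord s) -sum1_card.
  rewrite (partition_big (fun x => c (inl x)) xpredT) //=.
  rewrite mulnC -[X in _ * X]card_ord mulnC -sum_nat_const.
  apply: leq_sum => i _; rewrite sum1dep_card.
  by have := small i; rewrite -ltnNge -/(S i) ltn_predRL; lia.
pose Y : ksub k s := Sub X cX.
(* A vertex [v] of colour [i] would make [link_edge Y v] monochromatic. *)
have ci v : c (inr (Y, v)) != i.
  apply/eqP => cv; apply: (negP (ce (link_edge Y v) i _)).
    by rewrite inE imset2_f ?inE.
  apply/fintype.subsetP => y /setU1P [->|/imsetP [x /(fintype.subsetP XS)]].
    by rewrite inE cv.
  by rewrite !inE => /eqP cx ->; rewrite cx.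
(* [lift i] renumbers the [r] colours other than [i] by ['I_r]. *)
have /boolp.choice [c' c'E] : forall v : G, exists j, c (inr (Y, v)) = lift i j.
  by move=> v; have := ci v; rewrite eq_sym => /unlift_some [j ->]; exists j.
exists c' => e j eG.
apply: contra (ce (copy_edge Y e) (lift i j) _).
  move=> /fintype.subsetP ej; apply/fintype.subsetP => _ /imsetP [v /ej + ->].
  by rewrite !inE c'E => /eqP ->.
by rewrite inE orbC imset2_f ?inE.
Qed.

Lemma Fkr_not_colourable (k r : nat) :
  1 < k -> ~ colourable r.+1 (Fkr k r.+1).
Proof.
move=> k1; elim: r => [|r IH]; first exact: single_edge_not_colourable.
by apply: ext_not_colourable => //; rewrite addn1.
Qed.

(** * Neighbourhoods and codegrees *)

Definition nbr (H : hypergraph) (X : {set H}) : {set H} :=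
  [set v | (v |: X)%SET \in edges H]%SET.

Lemma degree_le_nbr (k : nat) (H : hypergraph) (X : {set H}) :
  0 < k -> uniform k H -> #|X| = k.-1 -> degree X <= #|nbr X|.
Proof.
move=> k0 /forall_inP uH cX.
apply: leq_trans (leq_imset_card (fun v => v |: X)%SET _).
apply/subset_leq_card/fintype.subsetP => e; rewrite inE => /andP [eH Xe].
have /cards1P [v ev] : #|e :\: X| == 1.
  rewrite cardsDS // cX (eqP (uH _ eH)).
  by case: k k0 {uH cX} => // k _; rewrite subSnn.
have eE : e = (v |: X)%SET.
  by rewrite -[LHS](finset.setID e X) ev (finset.setIidPr Xe) finset.setUC.
by apply/imsetP; exists v => //; rewrite inE -eE.
Qed.

(** Distinct vertices outside [X] extend it to distinct edges, hence the disjointness. *)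
Lemma card_le_degree (H : hypergraph) (X B : {set H}) :
  B \subset nbr X -> [disjoint B & X] -> #|B| <= degree X.
Proof.
move=> /fintype.subsetP BX dBX; rewrite -(@card_in_imset _ _ (fun v => v |: X)%SET).
  apply/subset_leq_card/fintype.subsetP => _ /imsetP [v /BX + ->].
  by rewrite !inE => ->; rewrite finset.subsetUr.
move=> v w vB wB /setP /(_ v); rewrite !inE eqxx (disjointFr dBX vB) !orbF.
by move=> /esym /eqP.
Qed.

(** * Embeddings forced by few non-neighbours *)

Definition embeds_in (F H : hypergraph) (U : {set H}) : Prop :=
  exists f : F -> H, [/\ injective f, forall v, f v \in U
    & forall e, e \in edges F -> f @: e \in edges H].

Lemma embeds_contains (F H : hypergraph) (U : {set H}) :
  embeds_in F U -> contains F H.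
Proof.
move=> [f [fI _ fe]]; apply/existsP; exists (finfun f).
apply/andP; split; first by apply/injectiveP => x y; rewrite !ffunE => /fI.
apply/forall_inP => e /fe; suff -> : finfun f @: e = f @: e by [].
by apply: eq_imset => x; rewrite ffunE.
Qed.

(* [d] bounds the number of non-neighbours in [U], so a large [U] means a
   codegree above [(a - 1) / a * #|U|] up to a constant. In contrast with a
   density, [d] does not increase when [U] shrinks, which suits the induction. *)
Definition forced (k a C : nat) (F : hypergraph) : Prop :=
  forall (H : hypergraph) (U : {set H}) (d : nat),
  (forall X : {set H}, X \subset U -> #|X| = k.-1 -> #|U :\: nbr X| <= d) ->
  a * d + C <= #|U| -> embeds_in F U.

Lemma single_edge_forced (k : nat) : 0 < k -> forced k 1 k (single_edge k).
Proof.
move=> k0 H U d Ud; rewrite mul1n => dU.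
have [|X XU cX] := @subset_of_card _ U k.-1; first by lia.
(* At least [k] vertices of [U] are in [nbr X], and [X] takes up only [k.-1] of them. Removing [X]
   matters because [forced] allows a non-uniform [H], where [nbr X] may meet [X]. *)
have : 0 < #|(U :&: nbr X) :\: X|.
  have := Ud X XU cX; have := cardsID (nbr X) U.
  have := cardsID X (U :&: nbr X).
  have : #|U :&: nbr X :&: X| <= #|X| by apply/subset_leq_card/finset.subsetIr.
  by lia.
case/card_gt0P => v; rewrite !inE => /and3P [vX vU vE].
have cA : #|v |: X| = k by rewrite cardsU1 vX cX; lia.
pose f (i : 'I_k) : H := enum_val (cast_ord (esym cA) i).
have fI : injective f by move=> i j /enum_val_inj /cast_ord_inj.
have fA i : f i \in (v |: X)%SET by apply: enum_valP.
exists f; split=> // [i|e /set1P ->].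
  by have /setU1P [->//|/(fintype.subsetP XU)] := fA i.
suff -> : f @: [set: 'I_k]%SET = (v |: X)%SET by [].
apply/eqP; rewrite eqEcard card_imset // cardsT card_ord cA leqnn andbT.
by apply/fintype.subsetP => _ /imsetP [i _ ->].
Qed.

(** The maps are chosen one index at a time, with [Z] the union of the images used so far, which
    never exceeds [#|I| * #|G|] points. The equation of pairs encodes both injectivity of each map
    and disjointness of the images. *)
Lemma greedy_disjoint_maps (I G T : finType) (Q : I -> (G -> T) -> Prop) :
  (forall i (Z : {set T}), #|Z| <= #|I| * #|G| ->
    exists f, [/\ injective f, Q i f & forall v, f v \notin Z]) ->
  exists g : I -> G -> T,
    (forall i j v w, g i v = g j w -> (i, v) = (j, w)) /\ forall i, Q i (g i).
Proof.
move=> ex.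
suff /(_ (enum I) (enum_uniq I)) [g [gI gQ]] : forall s : seq I, uniq s ->
    exists g : I -> G -> T,
    (forall i j v w, i \in s -> j \in s -> g i v = g j w -> (i, v) = (j, w)) /\
    forall i, i \in s -> Q i (g i).
  exists g; split=> [i j v w|i]; [apply: gI|apply: gQ]; by rewrite mem_enum.
elim=> [_|i s IH /= /andP [ins us]].
  (* Even the empty list needs a total family [g]; since [T] may be empty, its values come from
     [ex]. *)
  have /boolp.choice [g _] : forall i : I, exists f : G -> T, injective f.
    by move=> i; have [|f []] := ex i finset.set0; [rewrite cards0|exists f].
  by exists g.
have [g [gI gQ]] := IH us.
have [|f [fI fQ fZ]] := ex i [set g p.1 p.2 | p in finset.setX [set x in s]%SET [set: G]%SET]%SET.
  apply: leq_trans (leq_imset_card _ _) _.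
  by rewrite cardsX cardsT leq_mul2r max_card orbT.
have fg j v w : j \in s -> f v <> g j w.
  move=> js fgE; have /negP := fZ v; apply; apply/imsetP; exists (j, w) => //.
  by rewrite !inE js.
exists (fun j => if j == i then f else g j); split=> [j l v w|j].
  rewrite !inE; case: eqP => [->|_]; case: eqP => [->|_] //= js ls.
  - by move=> /fI ->.
  - by move/fg => /(_ ls).
  - by move/esym/fg => /(_ js).
  - exact: gI.
by rewrite inE; case: eqP => [->|_] //=; apply: gQ.
Qed.

Lemma ext_forced (k s a C : nat) (G : hypergraph) :
  forced k a C G -> forced k a.+1 (C + #|ext k s G|) (ext k s G).
Proof.
move=> FG H U d Ud dU.
have cE : #|ext k s G| = s + #|ksub k s| * #|G|.
  by rewrite card_sum card_ord card_prod.
have [|S SU cS] := @subset_of_card _ U s; first by lia.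
pose t (x : 'I_s) : H := enum_val (cast_ord (esym cS) x).
have tI : injective t by move=> i j /enum_val_inj /cast_ord_inj.
have tS x : t x \in S by apply: enum_valP.
have tU x : t x \in U by apply: (fintype.subsetP SU).
pose Q (X : ksub k s) (f : G -> H) :=
  [/\ forall v, f v \in U, forall v, f v \in nbr (t @: val X),
      forall v, f v \notin S & forall e, e \in edges G -> f @: e \in edges H].
have [|g [gI gQ]] := @greedy_disjoint_maps _ _ _ Q.
  move=> X Z cZ; pose N := nbr (t @: val X).
  have tX : t @: val X \subset U by apply/fintype.subsetP => _ /imsetP [x _ ->].
  have cX : #|t @: val X| = k.-1 by rewrite card_imset // (eqP (valP X)).
  (* Passing to [N] costs at most [d] vertices, and removing [S] and [Z] at most [#|ext k s G|]
     more, so [a * d + C] remain for the copy of [G]. *)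
  pose U' := ((U :&: N) :\: (S :|: Z))%SET.
  have U'U : U' \subset U.
    by apply/fintype.subsetP => v; rewrite !inE => /and3P [].
  have [Y YU cY||f [fI fU' fe]] := FG H U' d.
  - apply: leq_trans (Ud Y (fintype.subset_trans YU U'U) cY).
    by apply/subset_leq_card/finset.setSD.
  - have := Ud _ tX cX; have := cardsID N U.
    have := cardsID (S :|: Z) (U :&: N).
    have : #|U :&: N :&: (S :|: Z)| <= #|S :|: Z| by apply/subset_leq_card/finset.subsetIr.
    have [+ _] := leq_card_setU S Z.
    by rewrite -/U' -/N cS; move: dU; rewrite mulSn cE; lia.
  - exists f; split=> // [|v]; last by have := fU' v; rewrite !inE negb_or => /andP [/andP []].
    split=> // v; have := fU' v; rewrite !inE negb_or => /andP [/andP [? ?]] /andP [] //.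
pose f (y : ext k s G) : H := match y with inl x => t x | inr p => g p.1 p.2 end.
have gS X v : g X v \notin S by have [] := gQ X.
exists f; split.
- move=> [x|[X v]] [y|[Y w]] //=.
  + by move/tI ->.
  + by move=> tg; have := gS Y w; rewrite -tg tS.
  + by move=> tg; have := gS X v; rewrite tg tS.
  + by move/gI ->.
- by move=> [x|[X v]] //=; have [] := gQ X.
- move=> e /setUP [] /imset2P [X v _].
  + move=> _ ->; have [_ + _ _] := gQ X => /(_ v); rewrite inE.
    by rewrite /link_edge imsetU1 -imset_comp.
  + move=> vG ->; have [_ _ _ /(_ _ vG)] := gQ X.
    by rewrite /copy_edge -imset_comp.
Qed.

Lemma Fkr_forced (k r : nat) :
  0 < k -> exists C, forced k r.+1 C (Fkr k r.+1).
Proof.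
move=> k0; elim: r => [|r [C IH]]; first by exists k; apply: single_edge_forced.
by eexists; apply: ext_forced; apply: IH.
Qed.

(** * Upper and lower bounds on [coex] *)

Lemma leq_bigmin (I : finType) (P : pred I) (F : I -> nat) (n m : nat) :
  m <= n -> (forall i, P i -> m <= F i) -> m <= \big[minn/n]_(i | P i) F i.
Proof.
by move=> mn mF; elim/big_ind: _ => // x y mx my; rewrite leq_min mx.
Qed.

Lemma bigmin_leq_cond (I : finType) (P : pred I) (F : I -> nat) (n : nat) i :
  P i -> \big[minn/n]_(j | P j) F j <= F i.
Proof.
rewrite -big_filter => Pi.
have : i \in [seq j <- index_enum I | P j] by rewrite mem_filter Pi mem_index_enum.
elim: [seq j <- _ | _] => //= j s IH; rewrite inE big_cons geq_min.
by case/orP => [/eqP <-|/IH ->]; rewrite ?leqnn ?orbT.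
Qed.

Lemma bigmin_leq_id (I : finType) (P : pred I) (F : I -> nat) (n : nat) :
  \big[minn/n]_(i | P i) F i <= n.
Proof. by elim/big_rec: _ => // i x _; rewrite geq_min orbC => ->. Qed.

(** In an [F]-free [k]-graph of minimum codegree [m], each (k-1)-set has at most [n - m]
    non-neighbours, so [forced] yields [n < a * (n - m) + C]. *)
Lemma coex_upper (k a C n : nat) (F : hypergraph) :
  0 < k -> 0 < a -> forced k a C F -> a * coex k n F + n <= a * n + C.
Proof.
move=> k0 a0 FF; suff : coex k n F <= (a * n + C - n) %/ a.
  by rewrite leq_divRL // mulnC => h; nia.
apply/bigmax_leqP => E /andP [uE nF]; rewrite leq_divRL // mulnC.
set H := Hypergraph E in uE nF *; set m := min_codegree k H.
(* The default value of the minimum ensures that [n - m] is not truncated. *)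
have mn : m <= n by rewrite -[n]card_ord; apply: bigmin_leq_id.
suff : #|[set: H]%SET| < a * (n - m) + C by rewrite cardsT card_ord; nia.
rewrite ltnNge; apply/negP => big; move: nF => /negP; apply.
apply: embeds_contains (FF _ _ _ _ big) => X _ cX; rewrite finset.setTD.
have := cardsC (nbr X); have := degree_le_nbr k0 uE cX.
have : m <= degree X by apply: bigmin_leq_cond; rewrite cX.
by rewrite card_ord; lia.
Qed.

(** Within a residue class, [x] is determined by its quotient, which is at most [n %/ r.+1]. *)
Lemma card_residue_class (n r : nat) (i : 'I_r.+1) :
  #|[set x : 'I_n | inord (x %% r.+1) == i]%SET| <= (n %/ r.+1).+1.
Proof.
pose f (x : 'I_n) : 'I_(n %/ r.+1).+1 := inord (x %/ r.+1).
rewrite -[leqRHS]card_ord -(@card_in_imset _ _ f) ?max_card // => x y.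
rewrite !inE => /eqP <- /eqP /(congr1 val) /=.
rewrite !inordK ?ltn_pmod // => modE /(congr1 val) /=.
rewrite !inordK ?ltnS ?leq_div2r // 1?ltnW // => divE.
by apply/val_inj; rewrite /= (divn_eq x r.+1) (divn_eq y r.+1) modE divE.
Qed.

Lemma coex_lower (k r n : nat) (F : hypergraph) :
  1 < k -> ~ colourable r.+1 F -> n <= coex k n F + (n %/ r.+1 + k).
Proof.
move=> k1 nF; pose part i := [set x : 'I_n | inord (x %% r.+1) == i :> 'I_r.+1]%SET.
pose E := [set e : {set 'I_n} | (#|e| == k) && [forall i, ~~ (e \subset part i)]]%SET.
have partE (e : {set 'I_n}) i : e \in E -> ~~ (e \subset part i).
  by rewrite inE => /andP [_ /forallP].
have EF : uniform k (Hypergraph E) && ~~ contains F (Hypergraph E).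
  apply/andP; split; first by apply/forall_inP => e; rewrite inE => /andP [].
  apply/negP => /colourable_contains FE; apply: nF; apply: FE; apply/colourableP.
  by exists (fun x : 'I_n => inord (x %% r.+1)) => e i; apply: partE.
have [q qE] : exists q, q = n %/ r.+1 by eexists.
rewrite -qE addnC -leq_subLR addnC subnDA; apply: (bigop.bigmax_sup E EF).
apply: leq_bigmin => [|X /eqP cX]; first by rewrite card_ord; lia.
(* [A] collects the vertices that may fail to complete [X] to an edge: the whole class containing
   [X] if there is one, and otherwise only [X] itself. *)
have degX (A : {set 'I_n}) : X \subset A -> #|A| <= q + k ->
    (forall v i, v \notin A -> ~~ ((v |: X)%SET \subset part i)) ->
    n - k - q <= degree (X : {set Hypergraph E}).
  move=> XA cA Ae.
  apply: (@leq_trans #|(~: A)%SET|).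
    by have := cardsC A; rewrite card_ord; lia.
  apply: (@card_le_degree (Hypergraph E)).
  - apply/fintype.subsetP => v; rewrite !inE => vA; rewrite cardsU1 cX.
    rewrite (contraNN (fintype.subsetP XA v) vA) /=.
    by apply/andP; split; [lia|apply/forallP => i; apply: Ae].
  - by apply/pred0P => v /=; rewrite inE; apply/negP => /andP [/negP vA /(fintype.subsetP XA)].
have [/existsP [i Xi]|/existsPn Xi] := boolP [exists i, X \subset part i].
  apply: (degX (part i)) => // [|v j vi].
    by apply: leq_trans (card_residue_class n i) _; rewrite -qE; lia.
  apply/negP => /fintype.subsetP vXj.
  (* As [k > 1], [X] has a vertex; it lies in both classes, so [j = i] and [v] would lie in
     [part i]. *)
  have /card_gt0P [x xX] : 0 < #|X| by rewrite cX; lia.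
  have := fintype.subsetP Xi x xX; rewrite inE => /eqP xi.
  have := vXj x (setU1r _ xX); rewrite inE xi => /eqP ij.
  by move/negP: vi; apply; rewrite ij; apply/vXj/setU11.
apply: (degX X) => // [|v i _]; first by rewrite cX; lia.
by apply: contra (Xi i); apply/fintype.subset_trans/finset.subsetUr.
Qed.

(** * Convergence of the codegree ratio *)

Lemma coex_ratio_cvg (R : realType) (k a C : nat) (F : hypergraph) :
  (forall n, a.+1 * coex k n F + n <= a.+1 * n + C) ->
  (forall n, n <= coex k n F + (n %/ a.+1 + k)) ->
  (coex_ratio R k F @ \oo --> ((a.+1%:R - 1) / a.+1%:R : R)%R)%classic.
Proof.
(* The shift avoids division by zero at [n = 0] and matches [harmonic n], the inverse of [n.+1]. *)
move=> up lo; rewrite -cvg_shiftS.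
set l := (_ / _)%R.
apply: (@squeeze_cvgr _ _ _ _ (fun n => l - k%:R * harmonic n)%R
                              (fun n => l + C%:R * harmonic n)%R).
- apply: nearW => n; set N := n.+1.
  have N0 : (0 < N%:R :> R)%R by rewrite ltr0n.
  have a0 : (0 < a.+1%:R :> R)%R by rewrite ltr0n.
  have -> : harmonic n = (N%:R^-1 :> R)%R by [].
  have lE : (a.+1%:R * l = a.+1%:R - 1 :> R)%R by rewrite mulrC divfK // gt_eqF.
  have NV : (N%:R * N%:R^-1 = 1 :> R)%R by rewrite mulfV // gt_eqF.
  rewrite /coex_ratio ler_pdivlMr // ler_pdivrMr //.
  rewrite -(ler_pM2l a0) -[X in _ && X](ler_pM2l a0).
  (* Multiplying by [a.+1] and [N] clears all denominators, so both squeeze inequalities become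
     linear; [x] is [C] or [- k]. *)
  have expand (x : R) : (a.+1%:R * ((l + x * N%:R^-1) * N%:R) =
      (a.+1%:R - 1) * N%:R + a.+1%:R * x)%R.
    by rewrite -lE mulrDl -(mulrA x) [(_^-1 * _)%R]mulrC NV mulr1 mulrDr mulrA.
  rewrite -mulNr !expand.
  have upN : (a.+1%:R * (coex k N F)%:R + N%:R <= a.+1%:R * N%:R + C%:R :> R)%R.
    by rewrite -!natrM -!natrD ler_nat.
  have loN : (a.+1%:R * N%:R <= a.+1%:R * (coex k N F)%:R + N%:R + a.+1%:R * k%:R :> R)%R.
    rewrite -!natrM -!natrD ler_nat; have := lo N; have := leq_divM N a.+1; nia.
  have CC : (C%:R <= a.+1%:R * C%:R :> R)%R by rewrite -natrM ler_nat leq_pmull.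
  by apply/andP; split; lra.
- rewrite -[X in (_ --> X)%classic]subr0 -[X in (_ - X)%R](mulr0 k%:R%R).
  by apply: cvgB; [exact: cvg_cst|apply: cvgMr; exact: cvg_harmonic].
- rewrite -[X in (_ --> X)%classic]addr0 -[X in (_ + X)%R](mulr0 C%:R%R).
  by apply: cvgD; [exact: cvg_cst|apply: cvgMr; exact: cvg_harmonic].
Qed.

Unset Implicit Arguments.
Set Strict Implicit.

Theorem theorem3p2 (R : realType) (k : nat) (hk : (3 <= k)%N)
    (r : nat) (hr : (1 <= r)%N) :
  ~ colourable r (Fkr k r) /\
  (cvgn (coex_ratio R k (Fkr k r)) /\
   codegree_density R k (Fkr k r) = ((r%:R - 1) / r%:R)%R).
Proof.
case: r hr => // r _.
have k1 : 1 < k by apply: leq_trans hk.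
have nF := @Fkr_not_colourable k r k1; split=> //.
have [C FC] := Fkr_forced r (ltnW k1).
have lim : (coex_ratio R k (Fkr k r.+1) @ \oo --> ((r.+1%:R - 1) / r.+1%:R : R)%R)%classic.
  apply: coex_ratio_cvg => n; first exact: coex_upper (ltnW k1) _ FC.
  exact: coex_lower k1 nF.
by split; [apply/cvg_ex; eexists; exact: lim|exact: cvg_lim lim].
Qed.
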